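(* Let $0<q<1$ and let $\{p_n(z;q)\}_{n\in\mathbb N_0}$ be an odd $q$-Lidstone polynomial sequence of type I. Let $\pi_{ij}=\sum_{n=0}^i a_{in}b_{(n+1)j}$ $(i,j\in\mathbb N_0)$, with $a_{ij},b_{ij}$ as in the context. Then $p_0(z;q)=\frac1{\beta_0}z$ and for every $n\in\mathbb N_0$ $$p_{n+1}(z;q)= \frac{(-1)^{n+1}\,p_0(z;q)}{\pi_{01}\pi_{12} \cdots \pi_{n(n+1)}}\;\det\begin{bmatrix} \pi_{00}-z^2 & \pi_{01} & 0 & \cdots & 0 \\ \pi_{10} & \pi_{11}-z^2 & \pi_{12} & \cdots & 0 \\ \pi_{20} & \pi_{21} & \pi_{22}-z^2 & \ddots & \vdots \\ \vdots & \vdots & \vdots & \ddots & \pi_{(n-1)n}\\ \pi_{n0} & \pi_{n1} & \pi_{n2} & \cdots & \pi_{nn}-z^2 \end{bmatrix},$$ i.e. the determinant is that of the $(n+1)\times(n+1)$ matrix $[\pi_{ij}-z^2\delta_{ij}]_{0\le i,j\le n}$ (where $\pi_{ij}=0$ for $j>i+1$).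
   Context: Fix $0<q<1$. Put $[m]_q=\frac{1-q^m}{1-q}$, $[m]_q!=\prod_{j=1}^m[j]_q$, $[0]_q!=1$, and ${n \brack k}_q=\frac{[n]_q!}{[k]_q!\,[n-k]_q!}$ for $0\le k\le n$. $\mathbb N=\{1,2,\dots\}$, $\mathbb N_0=\mathbb N\cup\{0\}$. The Jackson $q$-derivative is $D_qf(z)=\frac{f(qz)-f(z)}{(q-1)z}$ for $z\ne0$ and $D_qf(0)=f'(0)$, so $D_qz^m=[m]_qz^{m-1}$. An odd $q$-Lidstone polynomial sequence of type I (class $q$OLS-I) is a sequence $\{p_n(z;q)\}_{n\in\mathbb N_0}$ of polynomials in $z$ with real coefficients such that $D_q^2p_n(z;q)=[2n+1]_q[2n]_q\,p_{n-1}(z;q)$ for $n\in\mathbb N$, $p_n(0;q)=0$ for $n\in\mathbb N_0$, and $p_0(z;q)=\alpha_0z$ with $\alpha_0\in\mathbb R\setminus\{0\}$. Its associated numerical sequence is $\alpha_{2n}:=D_qp_n(0;q)$, and $p_n(z;q)=\sum_{k=0}^n {2n+1 \brack 2k+1}_q\frac{\alpha_{2(n-k)}}{[2(n-k)+1]_q}z^{2k+1}$. The sequence $(\beta_{2n})_{n\ge0}$ is the unique real sequence with $\sum_{j=0}^n \frac{\beta_{2j}\,\alpha_{2(n-j)}}{[2j+1]_q!\,[2(n-j)+1]_q!}=\delta_{n0}$ for all $n\in\mathbb N_0$. For $i\ge j$ put $a_{ij}={2i+1 \brack 2j+1}_q\frac{\alpha_{2(i-j)}}{[2(i-j)+1]_q}$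 and $b_{ij}={2i+1 \brack 2j+1}_q\frac{\beta_{2(i-j)}}{[2(i-j)+1]_q}$; for $i<j$ put $a_{ij}=b_{ij}=0$. *)

(* Defs.v *)
From HB Require Import structures.
From mathcomp Require Import all_boot all_order all_algebra.
From mathcomp Require Import all_classical all_reals all_analysis.
Set Implicit Arguments.
Unset Strict Implicit.
Unset Printing Implicit Defensive.
Import Order.TTheory GRing.Theory Num.Theory.
Import numFieldNormedType.Exports.
Local Open Scope ring_scope.

Definition qnum (R : realType) (q : R) (m : nat) : R :=
  (1 - q ^+ m) / (1 - q).

Definition qfact (R : realType) (q : R) (m : nat) : R :=
  \prod_(1 <= j < m.+1) qnum q j.

(* Meaningful for k <= n only, since n - k is truncated. *)
Definition qbinom (R : realType) (q : R) (n k : nat) : R :=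
  qfact q n / (qfact q k * qfact q (n - k)%N).

Definition jackson (R : realType) (q : R) (f : R -> R) (z : R) : R :=
  if z == 0 then (f^`())%classic 0
  else (f (q * z) - f z) / ((q - 1) * z).

Definition odd_qLidstone_I (R : realType) (q : R) (p : nat -> {poly R}) : Prop :=
  [/\ forall n, (0 < n)%N -> forall z,
        jackson q (jackson q (horner (p n))) z =
          qnum q (2 * n + 1) * qnum q (2 * n) * (p n.-1).[z],
      forall n, (p n).[0] = 0
    & exists2 alpha0 : R, alpha0 != 0 & p 0%N = alpha0 *: 'X].

(* Sequences with even indices are re-indexed by half the index:             *)
(* assoc_seq q p n is alpha_{2n}, and beta n below stands for beta_{2n}.     *)
Definition assoc_seq (R : realType) (q : R) (p : nat -> {poly R}) (n : nat) : R :=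
  jackson q (horner (p n)) 0.

Definition conj_seq (R : realType) (q : R) (alpha beta : nat -> R) : Prop :=
  forall n, \sum_(j < n.+1)
      (beta j * alpha (n - j)%N) /
        (qfact q (2 * j + 1) * qfact q (2 * (n - j) + 1)) = (n == 0%N)%:R.

(* The entries a_ij for s = alpha, and b_ij for s = beta. *)
Definition ols_coef (R : realType) (q : R) (s : nat -> R) (i j : nat) : R :=
  if (j <= i)%N then
    qbinom q (2 * i + 1) (2 * j + 1) * (s (i - j)%N / qnum q (2 * (i - j) + 1))
  else 0.

Definition prod_coef (R : realType) (q : R) (alpha beta : nat -> R)
    (i j : nat) : R :=
  \sum_(n < i.+1) ols_coef q alpha i n * ols_coef q beta n.+1 j.

(* Main.v *)
Require Import Defs.
From HB Require Import structures.
From mathcomp Require Import all_boot all_order all_algebra.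
From mathcomp Require Import all_classical all_reals all_analysis.
From mathcomp Require Import ring zify.
Set Implicit Arguments.
Unset Strict Implicit.
Unset Printing Implicit Defensive.
Import Order.TTheory GRing.Theory Num.Theory.
Import numFieldNormedType.Exports.
Local Open Scope ring_scope.

(* The matrices A = (a_ij) and B = (b_ij) are lower triangular and inverse to
   each other, and the rows of A are the coefficients of the p_i on the odd
   monomials z^(2k+1). Multiplication by z^2 shifts these monomials, so
   re-expanding z^2 p_i in the basis (p_j) gives the recurrence
   z^2 p_i = \sum_(j <= i+1) pi_ij p_j with pi = A (shift) B. The determinant
   formula is Cramer's rule for the first n+1 of these equations, seen as a
   linear system in p_0, ..., p_n whose right-hand side involves p_(n+1) only. *)

(** Cramer's rule through the adjugate: no division occurs, so it applies over [{poly R}]. *)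
Lemma hessenberg_det_rec (R : comNzRingType) (f : nat -> nat -> R) (P : nat -> R)
    (n : nat) :
  (forall i j, (i.+1 < j)%N -> f i j = 0) ->
  (forall i, \sum_(j < i.+2) f i j * P j = 0) ->
  P 0%N * \det (\matrix_(i < n.+1, j < n.+1) f i j) =
    (-1) ^+ n.+1 * (\prod_(i < n.+1) f i i.+1) * P n.+1.
Proof.
move=> f0 frec; set A := \matrix_(i, j) _.
pose v : 'cV[R]_n.+1 := \col_j P j.
(* Each row but the last contains the whole recurrence, hence gives 0; the last one lacks only its
   term in [P n.+1]. *)
have Av (k : 'I_n.+1) : (A *m v) k ord0 = - (f n n.+1 * P n.+1) *+ (k == ord_max).
  have -> : (A *m v) k ord0 = \sum_(j < n.+1) f k j * P j.
    by rewrite mxE; apply: eq_bigr => j _; rewrite !mxE.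
  have [-> /=|kn] := eqVneq k ord_max.
    have := frec n; rewrite big_ord_recr /= => /eqP; rewrite addr_eq0 => /eqP ->.
    by rewrite mulr1n.
  have k2n : (k.+2 <= n.+1)%N.
    by have := ltn_ord k; move: kn; rewrite -val_eqE /=; lia.
  rewrite -[LHS](big_mkord xpredT (fun j => f k j * P j)).
  rewrite (big_cat_nat (leq0n _) k2n) //= [X in _ + X]big_nat_cond [X in _ + X]big1.
    by rewrite addr0 big_mkord frec.
  by move=> j /andP[/andP[kj _] _]; rewrite f0 ?mul0r.
(* Deleting the last row and the first column moves the superdiagonal onto the diagonal of a lower
   triangular matrix. *)
have minor : \det (row' ord_max (col' ord0 A)) = \prod_(i < n) f i i.+1.
  rewrite det_trig.
    by apply: eq_bigr => i _; rewrite !mxE lift_max lift0.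
  apply/is_trig_mxP => i j ij; by rewrite !mxE lift_max lift0 f0.
have /matrixP/(_ ord0 ord0) := congr1 (mulmx^~ v) (mul_adj_mx A).
rewrite mul_scalar_mx -mulmxA [RHS]mxE mxE (bigD1 ord_max) //= big1 => [|k kn].
  rewrite Av eqxx !mxE /= /cofactor minor addn0 addr0 => detE.
  by rewrite mulrC -detE big_ord_recr /= exprS; ring.
by rewrite Av (negbTE kn) mulr0.
Qed.

(** The numerals below [size (p - r)] are distinct in characteristic 0, and would be too many roots
    for a nonzero [p - r]. *)
Lemma horner_inj (R : numDomainType) (p r : {poly R}) :
  (forall z, p.[z] = r.[z]) -> p = r.
Proof.
move=> pr; apply/eqP; rewrite -subr_eq0; apply/eqP.
apply: (@roots_geq_poly_eq0 _ _ [seq i%:R | i <- iota 0 (size (p - r))]).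
- by apply/allP => x _; rewrite rootE !hornerE pr subrr.
- by rewrite map_inj_uniq ?iota_uniq // => i j /eqP; rewrite eqr_nat => /eqP.
- by rewrite size_map size_iota.
Qed.

Lemma sum_odd_index (R : pzRingType) (c : nat -> R) (N m : nat) :
  \sum_(k < N) c k * (m == k.*2.+1)%:R = c m./2 *+ (odd m && (m./2 < N)%N).
Proof.
have [/andP[om mN]|h] := boolP (odd m && (m./2 < N)%N).
  rewrite (bigD1 (Ordinal mN)) //= big1 => [|k].
    by rewrite -[X in X == _]odd_double_half om add1n eqxx mulr1 addr0.
  rewrite -val_eqE /= => km; case: eqP => [mk|]; last by rewrite mulr0.
  by move: km; rewrite mk /= uphalf_double eqxx.
rewrite big1 // => k _; case: eqP => [mk|]; last by rewrite mulr0.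
by move: h; rewrite mk /= odd_double uphalf_double ltn_ord.
Qed.

(** * The Jackson derivative on polynomials and the triangular matrices A and B *)

Section QCalculus.
Variables (R : realType) (q : R).

Definition qderiv (p : {poly R}) : {poly R} :=
  \poly_(k < (size p).-1) (qnum q k.+1 * p`_k.+1).

Lemma coef_qderiv p k : (qderiv p)`_k = qnum q k.+1 * p`_k.+1.
Proof.
rewrite coef_poly; case: ltnP => // h.
by rewrite nth_default ?mulr0 //; move: h; case: size.
Qed.

Hypotheses (hq0 : 0 < q) (hq1 : q < 1).

Lemma jackson_horner p z : jackson q (horner p) z = (qderiv p).[z].
Proof.
have q1 : 1 - q != 0 by rewrite subr_eq0 gt_eqF.
have q1' : q - 1 != 0 by rewrite subr_eq0 lt_eqF.
rewrite /jackson; case: eqVneq => [->|z0].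
  (* At 0 the ordinary derivative agrees with the formal one because [qnum q 1] is 1. *)
  rewrite -derivE !horner_coef0 coef_deriv coef_qderiv mulr1n.
  by rewrite /qnum expr1 divff // mul1r.
set n := (size p).-1.
have sp : (size p <= n.+1)%N := leqSpred _.
rewrite !(horner_coef_wide _ sp) -sumrB big_ord_recl /= !expr0 subrr add0r.
rewrite (horner_coef_wide _ (size_poly _ _)) mulr_suml; apply: eq_bigr => i _.
rewrite coef_qderiv /qnum /bump /= add1n exprMn !exprS.
by field; rewrite q1 z0 q1'.
Qed.

Lemma qnum_neq0 m : (0 < m)%N -> qnum q m != 0.
Proof.
move=> m0; apply: mulf_neq0; last by rewrite invr_eq0 subr_eq0 gt_eqF.
by rewrite subr_eq0 gt_eqF // exprn_ilt1 ?ltW // -lt0n.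
Qed.

Lemma qfactS m : qfact q m.+1 = qfact q m * qnum q m.+1.
Proof. by rewrite /qfact big_nat_recr. Qed.

Lemma qfact0 : qfact q 0 = 1.
Proof. by rewrite /qfact big_geq. Qed.

Lemma qfact1 : qfact q 1 = 1.
Proof.
by rewrite qfactS qfact0 mul1r /qnum expr1 divff // subr_eq0 gt_eqF.
Qed.

Lemma qfact_neq0 m : qfact q m != 0.
Proof.
by elim: m => [|m IH]; rewrite ?qfact0 ?oner_neq0 // qfactS mulf_neq0 ?qnum_neq0.
Qed.

(** This form shows a Toeplitz matrix conjugated by a diagonal one, so that matrix products become
    convolutions of sequences. *)
Lemma ols_coefE s i j : (j <= i)%N ->
  ols_coef q s i j = qfact q (2 * i + 1) / qfact q (2 * j + 1) *
    (s (i - j)%N / qfact q (2 * (i - j) + 1)).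
Proof.
move=> ji; rewrite /ols_coef ji /qbinom.
have -> : (2 * i + 1 - (2 * j + 1) = 2 * (i - j))%N by lia.
rewrite addn1 addn1 addn1 (qfactS (2 * (i - j))).
by field; rewrite !qfact_neq0 qnum_neq0.
Qed.

Lemma ols_coef_gt s i j : (i < j)%N -> ols_coef q s i j = 0.
Proof. by rewrite /ols_coef ltnNge => /negbTE ->. Qed.

Lemma ols_coef0 s i : ols_coef q s i 0 = s i.
Proof.
rewrite ols_coefE // subn0 muln0 add0n qfact1.
by field; exact: qfact_neq0.
Qed.

Lemma ols_coef_diag s i : ols_coef q s i i = s 0%N.
Proof.
rewrite ols_coefE // subnn muln0 add0n qfact1.
by field; exact: qfact_neq0.
Qed.

(** This is the equation for [D_q^2] read on the coefficient of z^(2k+1); it holds because [s]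
    enters only through n - k. *)
Lemma ols_coefS s n k :
  ols_coef q s n.+1 k.+1 * (qnum q k.*2.+3 * qnum q k.*2.+2) =
  qnum q (2 * n.+1 + 1) * qnum q (2 * n.+1) * ols_coef q s n k.
Proof.
have [kn|nk] := leqP k n; last by rewrite !ols_coef_gt // mul0r mulr0.
rewrite !ols_coefE // subSS.
have dblS m : (2 * m.+1 + 1 = (2 * m + 1).+2)%N by lia.
have dblS' m : (2 * m.+1 = (2 * m + 1).+1)%N by lia.
have -> : (k.*2.+3 = (2 * k + 1).+2)%N by lia.
have -> : (k.*2.+2 = (2 * k + 1).+1)%N by lia.
rewrite !dblS dblS' !qfactS.
by field; rewrite !qfact_neq0 !qnum_neq0.
Qed.

Lemma prod_coef_gt alpha beta i j :
  (i.+1 < j)%N -> prod_coef q alpha beta i j = 0.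
Proof.
move=> ij; rewrite /prod_coef big1 // => n _.
by rewrite [X in _ * X]ols_coef_gt ?mulr0 //; have := ltn_ord n; lia.
Qed.

Lemma prod_coef_superdiag alpha beta i :
  prod_coef q alpha beta i i.+1 = alpha 0%N * beta 0%N.
Proof.
rewrite /prod_coef big_ord_recr /= !ols_coef_diag big1 ?add0r // => n _.
by rewrite [X in _ * X]ols_coef_gt ?mulr0 // ltnS.
Qed.

Lemma conj_seq0 alpha beta : conj_seq q alpha beta -> beta 0%N * alpha 0%N = 1.
Proof.
move=> /(_ 0%N); rewrite big_ord_recl big_ord0 /= subnn muln0 add0n qfact1.
by rewrite addr0 mulr1 divr1.
Qed.

(** Triangularity confines j to l..k, where the sum is, up to a factor, the convolution of
    [conj_seq] at k - l. *)
Lemma ols_coef_inverse alpha beta N k l : conj_seq q alpha beta -> (k < N)%N ->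
  \sum_(j < N) ols_coef q beta k j * ols_coef q alpha j l = (k == l)%:R.
Proof.
move=> hbeta kN; have [kl|lk] := ltnP k l.
  rewrite (ltn_eqF kl) big1 // => j _; have [jk|kj] := leqP j k.
    by rewrite [X in _ * X]ols_coef_gt ?mulr0 //; lia.
  by rewrite ols_coef_gt ?mul0r.
rewrite -(big_mkord xpredT (fun j => ols_coef q beta k j * ols_coef q alpha j l)).
rewrite (big_cat_nat (leq0n k.+1) kN) /= [X in _ + X]big_nat_cond.
rewrite [X in _ + X]big1 ?addr0 => [|j /andP[/andP[kj _] _]]; last first.
  by rewrite ols_coef_gt ?mul0r.
rewrite (big_cat_nat (leq0n l)) /=; last by lia.
rewrite [X in X + _]big_nat_cond.
rewrite [X in X + _]big1 ?add0r => [|j /andP[/andP[_ jl] _]]; last first.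
  by rewrite [X in _ * X]ols_coef_gt ?mulr0.
(* Reversing the range gives [beta] the index j and [alpha] the index k - l - j, as in
   [conj_seq]. *)
rewrite -{1}[l]add0n big_addn subSn // big_mkord (reindex_inj rev_ord_inj) /=.
transitivity (qfact q (2 * k + 1) / qfact q (2 * l + 1) * (k - l == 0)%N%:R).
  rewrite -(hbeta (k - l)%N) mulr_sumr; apply: eq_bigr => j _.
  have jkl := ltn_ord j; rewrite subSS !ols_coefE; try lia.
  have -> : (k - (k - l - j + l) = j)%N by lia.
  have -> : (k - l - j + l - l = k - l - j)%N by lia.
  by field; rewrite !qfact_neq0.
rewrite subn_eq0; case: eqVneq => [->|kl].
  by rewrite leqnn divff ?mul1r ?qfact_neq0.
by rewrite leqNgt ltn_neqAle lk eq_sym kl mulr0.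
Qed.

(** * Expansions of the Lidstone polynomials and the recurrence for z^2 p_i *)

Section Lidstone.
Variables (p : nat -> {poly R}) (hp : odd_qLidstone_I q p).
Let alpha := assoc_seq q p.

Lemma assoc_seqE n : alpha n = (p n)`_1.
Proof.
rewrite /alpha /assoc_seq jackson_horner horner_coef0 coef_qderiv.
by rewrite /qnum expr1 divff ?mul1r // subr_eq0 gt_eqF.
Qed.

Lemma lidstone_coef_rec n m :
  (p n.+1)`_m.+2 * (qnum q m.+2 * qnum q m.+1) =
  qnum q (2 * n.+1 + 1) * qnum q (2 * n.+1) * (p n)`_m.
Proof.
have [hD _ _] := hp.
have /(congr1 (fun r : {poly R} => r`_m)) :
    qderiv (qderiv (p n.+1)) =
    (qnum q (2 * n.+1 + 1) * qnum q (2 * n.+1)) *: p n.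
  apply: horner_inj => z; rewrite hornerZ -(hD n.+1) // -jackson_horner.
  by congr (jackson q _ z); apply/funext => x; rewrite jackson_horner.
by rewrite coefZ !coef_qderiv => <-; ring.
Qed.

(** The equation for [D_q^2] determines the coefficients of degree at least 2 from p_(n-1), the
    q-numbers being nonzero; degree 0 comes from p_n(0) = 0 and degree 1 is [alpha n] itself. *)
Lemma lidstone_coef n m :
  (p n)`_m = if odd m then ols_coef q alpha n m./2 else 0.
Proof.
have [_ p0 [a0 a0n pE]] := hp.
elim: n m => [|n IH] [|[|m]] /=; rewrite -?horner_coef0 ?p0 ?ols_coef0 ?assoc_seqE //.
  rewrite pE coefZ coefX /= mulr0 negbK.
  by case: odd => //; rewrite ols_coef_gt.
have qq : qnum q m.+2 * qnum q m.+1 != 0 by rewrite mulf_neq0 ?qnum_neq0.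
apply: (mulIf qq); rewrite lidstone_coef_rec IH negbK.
have := odd_double_half m; case: (odd m) => mE; last by rewrite mulr0 mul0r.
by rewrite -ols_coefS; move: mE; rewrite add1n => ->.
Qed.

Lemma lidstone_expansion N n : (n < N)%N ->
  p n = \sum_(k < N) ols_coef q alpha n k *: 'X^(k.*2.+1).
Proof.
move=> nN; apply/polyP => m; rewrite lidstone_coef coef_sum.
under eq_bigr do rewrite coefZ coefXn.
rewrite sum_odd_index; case: odd => //=; case: ltnP => //= h.
by rewrite ols_coef_gt //; lia.
Qed.

Variables (beta : nat -> R) (hbeta : conj_seq q alpha beta).

Lemma monomial_expansion N k : (k < N)%N ->
  'X^(k.*2.+1) = \sum_(j < N) ols_coef q beta k j *: p j.
Proof.
move=> kN.
under eq_bigr => j _ do rewrite (lidstone_expansion (ltn_ord j)) scaler_sumr.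
rewrite exchange_big /=.
under eq_bigr => l _.
  under eq_bigr do rewrite scalerA.
  rewrite -scaler_suml ols_coef_inverse //; over.
rewrite (bigD1 (Ordinal kN)) //= eqxx scale1r big1 ?addr0 // => l.
by rewrite -val_eqE /= eq_sym => /negbTE ->; rewrite scale0r.
Qed.

Lemma lidstone_rec i :
  'X^2 * p i = \sum_(j < i.+2) prod_coef q alpha beta i j *: p j.
Proof.
rewrite (lidstone_expansion (ltnSn i)) mulr_sumr.
under eq_bigr => k _.
  (* Multiplication by z^2 sends the odd monomial of index k to that of index k+1, at most i+1;
     hence the range [i.+2]. *)
  rewrite -scalerAr -exprD add2n -[k.*2.+3]/(k.+1.*2.+1).
  rewrite (@monomial_expansion i.+2 k.+1 (ltn_ord k)) scaler_sumr; over.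
rewrite exchange_big /=; apply: eq_bigr => j _.
by rewrite /prod_coef scaler_suml; apply: eq_bigr => k _; rewrite scalerA.
Qed.

End Lidstone.
End QCalculus.

Theorem theorem2p23 (R : realType) (q : R) (hq0 : 0 < q) (hq1 : q < 1)
    (p : nat -> {poly R}) (hp : odd_qLidstone_I q p)
    (beta : nat -> R) (hbeta : conj_seq q (assoc_seq q p) beta) :
  let pi_ := prod_coef q (assoc_seq q p) beta in
  [/\ p 0%N = (1 / beta 0%N) *: 'X,
      forall i j : nat, (i.+1 < j)%N -> pi_ i j = 0
    & forall n : nat,
        p n.+1 = ((-1) ^+ n.+1 / \prod_(i < n.+1) pi_ i i.+1) *:
          (p 0%N * \det (\matrix_(i < n.+1, j < n.+1)
                           ((pi_ i j)%:P - 'X^2 * (i == j)%:R)))].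
Proof.
move=> pi_.
have ba1 := conj_seq0 hq1 hbeta.
have b0 : beta 0%N != 0.
  by apply/eqP => b0; move: ba1; rewrite b0 mul0r => /eqP; rewrite eq_sym oner_eq0.
split.
- rewrite (lidstone_expansion hq0 hq1 hp (ltnSn 0)) big_ord_recl big_ord0 addr0.
  by rewrite ols_coef0 // -ba1 mulrC mulKf.
- by move=> i j; exact: prod_coef_gt.
move=> n.
(* The matrix entries extended to all indices; z^2 stays off the superdiagonal, which is constantly
   alpha_0 beta_0 = 1. *)
pose f i j : {poly R} := (pi_ i j)%:P - 'X^2 * (i == j)%:R.
have fS i : f i i.+1 = 1.
  rewrite /f ltn_eqF // mulr0 subr0 /pi_ prod_coef_superdiag //.
  by rewrite mulrC ba1.
have -> : \prod_(i < n.+1) pi_ i i.+1 = 1.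
  by apply: big1 => i _; rewrite /pi_ prod_coef_superdiag // mulrC.
rewrite (@hessenberg_det_rec _ f p).
(* The sign of the formula cancels the one produced by the cofactor expansion. *)
- rewrite big1 // mulr1 divr1 -mul_polyC mulrA rmorphXn /= rmorphN1 -exprMn.
  by rewrite mulrNN mulr1 expr1n mul1r.
- move=> i j ij; rewrite /f /pi_ prod_coef_gt // ltn_eqF ?mulr0 ?subr0 //.
  by lia.
- move=> i; rewrite /f; under eq_bigr do rewrite mulrBl mul_polyC.
  rewrite sumrB -(lidstone_rec hq0 hq1 hp hbeta).
  (* The diagonal index j = i is the last but one of the range, and its term z^2 p_i alone
     survives. *)
  rewrite 2!big_ord_recr /= eqxx mulr1 ltn_eqF // mulr0 mul0r addr0.
  rewrite big1 ?add0r ?subrr // => j _.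
  by rewrite gtn_eqF // mulr0 mul0r.
Qed.
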